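(* For any integer $k\ge 1$ there exists a tree $H_k$ such that $\alpha_{\mathrm{bn}}(H_k)-\Gamma_b(H_k)\ge\alpha_{\mathrm{bnr}}(H_k)-\Gamma_b(H_k)\ge k$.
   Context: All graphs are finite and simple. Let $d(u,v)$ denote distance and $e(v)$ the eccentricity of $v$. A broadcast on a connected graph $G=(V,E)$ is a function $f:V\to\{0,1,\dots,\operatorname{diam}(G)\}$ with $f(v)\le e(v)$ for all $v\in V$ if $|V|\ge 2$, and $f(v)=1$ if $V=\{v\}$. Let $V_f^+=\{v: f(v)>0\}$ and $\sigma(f)=\sum_{v\in V}f(v)$ (the weight). A vertex $u$ hears $f$ from $v\in V_f^+$ (and $v$ dominates $u$) if $d(u,v)\le f(v)$. $f$ is dominating if every vertex hears $f$ from some vertex of $V_f^+$. A dominating broadcast $f$ is minimal dominating if no broadcast $g\neq f$ with $g(v)\le f(v)$ for all $v$ is dominating. $\Gamma_b(G)$ is the maximum weight of a minimal dominating broadcast of $G$. For $v\in V_f^+$ let $N_f(v)=\{u:d(u,v)\le f(v)\}$, $B_f(v)=\{u:d(u,v)=f(v)\}$, and let the private boundary $\operatorname{PB}_f(v)$ be the set of $u\in N_f(v)$ that are not dominated by the function obtained from $f$ by changing the value at $v$ to $f(v)-1$. $f$ is irredundant if $\operatorname{PB}_f(v)\ne\varnothing$ for each $v\in V_f^+$. $f$ is bn-independent if $N_f(u)\cap N_f(v)\subseteq B_f(u)\cap B_f(v)$ for all distinct $u,v\in V_f^+$; it is bnr-independent if it is bn-independent and irredundant. $\alpha_{\mathrm{bn}}(G)$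 and $\alpha_{\mathrm{bnr}}(G)$ are the maximum weights of a bn-independent and a bnr-independent broadcast on $G$, respectively. *)

(* Defs.v *)
(* Plain MathComp. A graph is a relation [e : rel T] on a finite type [T];
   [simple_graph] and [is_tree] state the axioms it has to satisfy. *)
From mathcomp Require Import all_boot all_order all_algebra.

Set Implicit Arguments.
Unset Strict Implicit.
Unset Printing Implicit Defensive.

Section Broadcasts.

Variables (T : finType) (e : rel T).

Definition simple_graph : Prop := symmetric e /\ irreflexive e.

Definition connected_graph : Prop :=
  0 < #|T| /\ forall u v : T, connect e u v.

Definition acyclic_graph : Prop :=
  forall c : seq T, 2 < size c -> ~~ (uniq c && cycle e c).

Definition is_tree : Prop :=
  [/\ simple_graph, connected_graph & acyclic_graph].

Definition walk_of_length (u v : T) (n : nat) : bool :=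
  [exists p : n.-tuple T, path e u p && (last u p == v)].

(* The least length of a walk from u to v; a shortest walk has length < #|T|,
   and the value is the junk #|T| when u and v are not connected. *)
Definition dist (u v : T) : nat := find (walk_of_length u v) (iota 0 #|T|).

Definition ecc (v : T) : nat := \max_(u : T) dist v u.

Definition diam : nat := \max_(v : T) ecc v.

(* Functions V -> {0, ..., diam}, except that the one-vertex graph (of
   diameter 0) must also admit the value 1. *)
Definition bfun : Type := {ffun T -> 'I_(maxn 1 diam).+1}.

Definition bval (f : bfun) : T -> nat := fun v => nat_of_ord (f v).

Coercion bval : bfun >-> Funclass.

Definition is_broadcast (f : T -> nat) : bool :=
  if #|T| == 1 then [forall v, f v == 1] else [forall v, f v <= ecc v].

Definition weight (f : T -> nat) : nat := \sum_(v : T) f v.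

Definition pos_set (f : T -> nat) : {set T} := [set v | 0 < f v].

Definition hears (f : T -> nat) (u v : T) : bool :=
  (v \in pos_set f) && (dist u v <= f v).

Definition dominated (f : T -> nat) (u : T) : bool := [exists v, hears f u v].

Definition dominating (f : T -> nat) : bool := [forall u, dominated f u].

Definition minimal_dominating (f : bfun) : bool :=
  [&& is_broadcast f, dominating f &
      [forall g : bfun,
         [&& is_broadcast g, g != f & [forall v, g v <= f v]]
           ==> ~~ dominating g]].

Definition nbhd (f : T -> nat) (v : T) : {set T} := [set u | dist u v <= f v].

Definition bdry (f : T -> nat) (v : T) : {set T} := [set u | dist u v == f v].

Definition lower_at (f : T -> nat) (v : T) : T -> nat :=
  fun w => if w == v then (f v).-1 else f w.

Definition private_bdry (f : T -> nat) (v : T) : {set T} :=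
  [set u in nbhd f v | ~~ dominated (lower_at f v) u].

Definition irredundant (f : T -> nat) : bool :=
  [forall v in pos_set f, private_bdry f v != set0].

Definition bn_independent (f : T -> nat) : bool :=
  [forall u in pos_set f, forall v in pos_set f,
     (u != v) ==> (nbhd f u :&: nbhd f v \subset bdry f u :&: bdry f v)].

Definition bnr_independent (f : T -> nat) : bool :=
  bn_independent f && irredundant f.

(* On a nonempty connected graph each of the three maxima below is taken over
   a nonempty family, so the default value 0 of \max plays no role. *)
Definition Gamma_b : nat := \max_(f : bfun | minimal_dominating f) weight f.

Definition alpha_bn : nat :=
  \max_(f : bfun | is_broadcast f && bn_independent f) weight f.

Definition alpha_bnr : nat :=
  \max_(f : bfun | is_broadcast f && bnr_independent f) weight f.

End Broadcasts.

(* Main.v *)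
Require Import Defs.
From mathcomp Require Import all_boot all_order all_algebra.
From mathcomp Require Import zify.

(** The tree has a centre c with m + 1 branches hanging from it.  In each of
    the first m branches the vertex a next to c has N further neighbours w, and
    every such a and w is the first vertex of its own path on five vertices
    (its chain).  The last branch is a star: a neighbour of c with N leaves.

    Broadcasting 4 from the far end of every chain and 1 from every leaf of the
    star is bnr-independent: the balls of the chain ends are exactly the
    chains, with the first vertex as private boundary, and the balls of the
    leaves meet only in the hub of the star, on their common boundary.  Only c
    hears nothing.  Its weight W is a lower bound for alpha_bnr.

    A minimal dominating broadcast f is irredundant: each broadcasting b has a
    vertex p b, at distance f b from b (or possibly b itself if f b = 1), that
    hears f from b only.  The geodesics from b to p b are pairwise disjoint: if
    those of b and b' meet in q with p b at least as close to q as p b', then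
    p b hears b' as well.  Two consequences (weight_bound):
    - within one chain the broadcasts whose geodesic stays in the chain weigh
      at most 4 together, and a leaf contributes at most 1;
    - every other geodesic runs through c, the hub of the star or some vertex
      a, so there are at most m + 2 of them, each of weight at most 12.
    So f exceeds W by a bounded multiple of m + 2 at most; the domination of c
    makes it lose more than that.

    If the first vertex of a chain hears f from outside the chain, it is not a
    private boundary, and the chain loses at least 1 unless its first vertex
    itself broadcasts at least 4.  In the same way a leaf of the star that
    hears f from another vertex loses its 1.  Suppose some z other than c
    dominates c.  If z is in the star, it also reaches all the leaves.
    Otherwise it reaches the first vertices of all N chains at the w of its
    branch; these chains, except the one of z, all lose 1, unless one of the w
    broadcasts at least 4, and then that w reaches all the leaves.  So at least
    N - 1 is lost, and N is taken large with respect to m (outer_center_lossy).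
    If only c dominates c, then
    c reaches every a, so the m chains at the a lose 1 each, and no geodesic
    except that of c leaves its cell, since the broadcast following it would
    reach c; the gain is at most 12, and m is k + 12 (center_only). *)

Set Implicit Arguments.
Unset Strict Implicit.
Unset Printing Implicit Defensive.

(** * Irredundance and private boundaries *)

Section PrivateBoundary.
Variables (T : finType) (e : rel T).

(** If the private boundary of v is empty, lowering f at v leaves a smaller
    dominating broadcast.  A one-vertex graph is excluded because its only
    broadcast cannot be lowered. *)
Lemma minimal_dominating_irredundant (f : bfun e) :
  1 < #|T| -> minimal_dominating f -> irredundant e f.
Proof.
move=> T1 /and3P[bf df /forallP mf].
apply/forallP=> v; apply/implyP; rewrite inE => fv; apply/negP=> /eqP PB0.
have lowP w : lower_at f v w <= f w by rewrite /lower_at; case: eqP => [->|//]; lia.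
have lt w : lower_at f v w < (maxn 1 (diam e)).+1.
  by apply: leq_ltn_trans (lowP w) _; exact: ltn_ord.
pose g : bfun e := [ffun w => Ordinal (lt w)].
have gE w : g w = lower_at f v w by rewrite /bval ffunE.
have := mf g; rewrite [X in X ==> _](_ : _ = true); last first.
  apply/and3P; split.
  - move: bf; rewrite /is_broadcast ifN ?ifN; try by rewrite neq_ltn T1 orbT.
    move=> /forallP bf; apply/forallP=> w.
    by rewrite gE (leq_trans (lowP w)).
  - by apply/eqP=> gf; move: (gE v); rewrite gf /lower_at eqxx; lia.
  - by apply/forallP=> w; rewrite gE.
move=> /= /negP; apply; apply/forallP=> u.
have dE : dominated e (lower_at f v) u -> dominated e g u.
  move=> /existsP[w]; rewrite /hears inE => hw; apply/existsP; exists w.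
  by rewrite /hears inE gE.
apply: dE; move/setP/(_ u): PB0; rewrite !inE.
case: (leqP (dist e u v) (f v)) => [_ /negbFE //|uv _].
move/forallP: df => /(_ u) /existsP[w]; rewrite /hears inE => /andP[fw uw].
apply/existsP; exists w; rewrite /hears inE /lower_at.
by case: (w =P v) uw => [->|_ ->]; [lia | rewrite fw].
Qed.

(** The upper bound on f b is an equality of f b with the distance, except that
    for f b = 1 the private vertex may be b itself. *)
Lemma irredundant_private (f : T -> nat) : irredundant e f ->
  exists p : T -> T, forall b, 0 < f b ->
    [/\ dist e (p b) b <= f b, f b <= maxn 1 (dist e (p b) b) &
        forall b', b' != b -> 0 < f b' -> f b' < dist e (p b) b'].
Proof.
move=> /forallP irr.
exists (fun b => odflt b [pick u in private_bdry e f b]) => b fb.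
have := irr b; rewrite inE fb /= => /set0Pn[x xP].
case: pickP => [u|/(_ x)]; last by rewrite xP.
rewrite !inE => /andP[ub /existsPn nd] /=; split => //.
  move: (nd b); rewrite /hears inE /lower_at eqxx; lia.
move=> b' bb' fb'; move: (nd b').
by rewrite /hears inE /lower_at (negbTE bb') fb' /= ltnNge.
Qed.

End PrivateBoundary.

(** * Trees presented by a metric and a parent map *)

(** A closed formula D for the distance, with a parent map along which D to any
    vertex that is not higher drops by one, determines a tree: two distinct
    vertices are joined by climbing down from the higher one. *)
Section ParentMetric.
Variables (T : finType) (D : T -> T -> nat) (par : T -> T) (h : T -> nat).
Hypotheses (Dsym : forall u v, D u v = D v u)
  (D0 : forall u v, (D u v == 0) = (u == v))
  (Dtri : forall u v w, D u w <= D u v + D v w)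
  (hpar : forall u, h (par u) <= h u)
  (Dpar : forall u v, h v <= h u -> u != v -> D u v = (D (par u) v).+1).

Definition unit_dist : rel T := fun u v => D u v == 1.

Let Dxx u : D u u = 0. Proof. by apply/eqP; rewrite D0. Qed.

Let unit_par u v : h v <= h u -> u != v -> D u (par u) = 1.
Proof.
move=> huv uv; have [pu|np] := eqVneq u (par u).
  by have := Dpar huv uv; rewrite -pu; lia.
by rewrite Dpar // Dxx.
Qed.

Let unit_sym : symmetric unit_dist.
Proof. by move=> u v; rewrite /unit_dist Dsym. Qed.

Lemma geodesic u v :
  exists p, [/\ path unit_dist u p, last u p = v & size p = D u v].
Proof.
move: {2}(D u v) (leqnn (D u v)) => n.
elim: n u v => [|n IHn] u v Dn.
  have /eqP uv : D u v == 0 by lia.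
  by exists [::]; split=> //=; apply/eqP; rewrite -D0 uv.
have [->|uv] := eqVneq u v; first by exists [::]; rewrite /= Dxx.
have [huv|hvu] := leqP (h v) (h u).
  have Duv := Dpar huv uv.
  have [|p [pp lp sp]] := IHn (par u) v; first by lia.
  exists (par u :: p); rewrite /= sp Duv; split=> //.
  by rewrite pp andbT /unit_dist (unit_par huv uv).
have vu : v != u by rewrite eq_sym.
have Dvu := Dpar (ltnW hvu) vu.
have [|p [pp lp sp]] := IHn u (par v).
  by rewrite Dsym; move: Dn; rewrite Dsym Dvu.
exists (rcons p v); rewrite rcons_path last_rcons size_rcons pp lp sp.
split=> //=; last by rewrite (Dsym u v) Dvu (Dsym u).
by rewrite unit_sym /unit_dist (unit_par (ltnW hvu) vu).
Qed.

Let path_dist u p : path unit_dist u p -> D u (last u p) <= size p.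
Proof.
elim: p u => [|w p IHp] u /=; first by rewrite Dxx.
move=> /andP[/eqP uw /IHp]; have := Dtri u w (last w p); lia.
Qed.

(** Walks cannot be shorter than D by the triangle inequality.  The search in
    the definition of the distance is cut off at the number of vertices, which
    D does not reach: a geodesic can be shortened to a duplicate-free one. *)
Lemma dist_unit_dist u v : dist unit_dist u v = D u v.
Proof.
have [p0 [pp0 lp0 sp0]] := geodesic u v.
have walk n p : path unit_dist u p -> last u p = v -> size p = n ->
    walk_of_length unit_dist u v n.
  move=> pp lp sp; apply/existsP; move/eqP: sp => sp.
  by exists (Tuple sp); rewrite /= pp lp eqxx.
have DT : D u v < #|T|.
  case/shortenP: pp0 lp0 => p pp up _ lp.
  have := path_dist pp; rewrite lp => Dp.
  apply: leq_ltn_trans Dp _; have /card_uniqP up1 := up; 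
  rewrite -[_ < _]/(size (u :: p) <= _) -up1.
  exact: max_card.
rewrite /dist; set w := walk_of_length _ _ _.
have wD : w (D u v) by apply: (walk _ p0).
have hw : has w (iota 0 #|T|).
  by apply/hasP; exists (D u v); rewrite // mem_iota.
have fT : find w (iota 0 #|T|) < #|T| by rewrite -{2}(size_iota 0 #|T|) -has_find.
apply/eqP; rewrite eqn_leq; apply/andP; split.
  rewrite leqNgt; apply/negP => /(before_find 0).
  by rewrite nth_iota // add0n wD.
have := nth_find 0 hw; rewrite nth_iota // add0n.
move=> /existsP[q /andP[pq /eqP lq]].
by have := path_dist pq; rewrite lq size_tuple.
Qed.

(** At a highest vertex of a cycle both neighbours would be its parent. *)
Lemma unit_dist_tree : 0 < #|T| -> is_tree unit_dist.
Proof.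
move=> T0; split.
- by split=> [//|u]; rewrite /unit_dist Dxx.
- split=> // u v; have [p [pp lp _]] := geodesic u v.
  by apply/connectP; exists p.
move=> c c2; apply/negP => /andP[uc cc].
have lower u v : unit_dist u v -> h v <= h u -> v = par u.
  move=> /eqP uv hvu; apply/eqP; rewrite eq_sym -D0.
  have uNv : u != v by rewrite -D0 uv.
  by have := Dpar hvu uNv; rewrite uv => -[<-].
have [x0 x0c] : exists x, x \in c.
  by case: c c2 {uc cc} => // a s _; exists a; rewrite mem_head.
case: (@arg_maxnP _ x0 (mem c) h x0c) => x xc hx.
have [i s cE] := rot_to xc.
have : 2 < size (x :: s) by rewrite -cE size_rot.
have : uniq (x :: s) by rewrite -cE rot_uniq.
have : cycle unit_dist (x :: s) by rewrite -cE rot_cycle.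
have hs y : y \in x :: s -> h y <= h x by rewrite -cE mem_rot; apply: hx.
case: s hs {cE} => [//|y s]; case/lastP: s => [//|s z] hs.
rewrite /= rcons_path last_rcons mem_rcons inE => /and3P[xy _ zx].
move=> /and3P[_ /norP[/eqP yz _] _] _; apply: yz.
have -> : y = par x by apply: lower => //; apply: hs; rewrite !inE eqxx orbT.
suff -> : z = par x by [].
apply: lower; first by rewrite unit_sym.
by apply: hs; rewrite !inE mem_rcons mem_head !orbT.
Qed.

End ParentMetric.

(** * Weight inside a path on five vertices *)

(** The path is numbered 0, ..., 4; F t is the value broadcast from t and P t a
    private vertex of t, here on the path too.  The intervals between t and P t
    are disjoint, and even a broadcast of value 1 that is its own private vertex
    needs the next place left free, so each broadcast uses up F t + 1 places
    before the next interval starts. *)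
Section ChainWeight.
Variables F P : nat -> nat.
Hypotheses (bdF : forall t, t < 5 -> 0 < F t ->
              [/\ P t < 5, (t - P t) + (P t - t) <= F t &
                  F t <= maxn 1 ((t - P t) + (P t - t))])
  (privF : forall s t, s < 5 -> t < 5 -> s != t -> 0 < F s -> 0 < F t ->
              F s < (s - P t) + (P t - s)).

Let bot t := minn t (P t).

Let bot_step s t : s < t < 5 -> 0 < F s -> 0 < F t ->
  bot s + F s < bot t.
Proof.
move=> /andP[st t5] Fs Ft; rewrite /bot.
have s5 : s < 5 by lia.
have [? ? ?] := bdF s5 Fs; have [? ? ?] := bdF t5 Ft.
have sNt : s != t by lia.
have := privF s5 t5 sNt Fs Ft.
have ts : t != s by lia.
have := privF t5 s5 ts Ft Fs; lia.
Qed.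

(** The weight that can still be placed when every interval starts at b or
    later: an interval to the end, or the value 1 at the last place. *)
Let room b := (4 - b) + (b == 4).

Let sum_above n b : n <= 5 ->
  (forall t, 5 - n <= t < 5 -> 0 < F t -> b <= bot t) ->
  \sum_(5 - n <= t < 5) F t <= room b.
Proof.
elim: n b => [|n IHn] b n5 hb; first by rewrite big_geq.
have t5 : 5 - n.+1 < 5 by lia.
have tE : (5 - n.+1).+1 = 5 - n by lia.
rewrite big_ltn // tE; set t := 5 - n.+1 in t5 tE hb *.
have [Ft0|Ft] := posnP (F t).
  by rewrite Ft0 add0n; apply: IHn => [|s hs]; [lia | apply: hb; lia].
have [Pt5 _ bdt] := bdF t5 Ft.
have bt : b <= bot t by apply: hb => //; lia.
have := IHn (bot t + F t).+1 (ltnW n5).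
have hs s : 5 - n <= s < 5 -> 0 < F s -> bot t + F t < bot s.
  by move=> hs Fs; apply: bot_step => //; lia.
move=> /(_ hs); move: bdt bt; rewrite /room /bot; lia.
Qed.

Lemma chain_weight : \sum_(0 <= t < 5) F t <= 4.
Proof. by apply: (@sum_above 5 0). Qed.

(** Weight 4 takes an interval with end 0.  When 0 is not private and broadcasts
    less than 4, the only way left is 3 from 0 together with 1 from 4; but P 0
    is then 3 and hears 4. *)
Lemma chain_weight_top : (forall t, t < 5 -> 0 < F t -> P t != 0) ->
  F 0 < 4 -> \sum_(0 <= t < 5) F t <= 3.
Proof.
move=> P0 F0; rewrite big_ltn //.
have [Ft0|Ft] := posnP (F 0).
  rewrite Ft0; apply: (@sum_above 4 1) => // t ht Ft; rewrite /bot.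
  by have := P0 t; lia.
have [Pt5 _ bdt] := bdF (isT : 0 < 5) Ft.
have := @sum_above 4 (bot 0 + F 0).+1 isT.
have hs s : 5 - 4 <= s < 5 -> 0 < F s -> bot 0 + F 0 < bot s.
  by move=> hs Fs; apply: bot_step => //; lia.
move=> /(_ hs); rewrite [5 - 4]/= /bot min0n add0n.
set rest := \sum_(1 <= t < 5) F t.
have [F3|F3] := ltnP (F 0) 3; first by rewrite /room; lia.
(* Here 0 broadcasts 3 and its private vertex is 3, so 4 has to be silent. *)
have F_high s : s < 5 -> 0 < s -> F s = 0.
  move=> s5 s0; case: (posnP (F s)) => // Fs.
  have := hs s; have := privF s5 (isT : 0 < 5); rewrite /bot; lia.
move=> _; rewrite /rest big_nat big1 => [|s /andP[? ?]]; last by rewrite F_high.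
by lia.
Qed.

End ChainWeight.

(** * The tree and its metric *)

(** A cell is the centre (None) or belongs to a branch b : option 'I_m, as its
    root (Some (b, None)) or as one of the N children of the root.  In the
    branches Some i every cell is the first vertex together with its chain; in
    the star, branch None, and at the centre a cell is a single vertex. *)
Section TreeMetric.
Variables m N : nat.

Definition cell : finType := option (option 'I_m * option 'I_N).

Definition clen (x : cell) := if x is Some (Some _, _) then 5 else 1.

(** The largest weight that the broadcasts with a private vertex in their own
    cell can reach there.  The centre and the hub of the star get 0: a geodesic
    through one of them, even a trivial one, is counted elsewhere. *)
Definition cap (x : cell) :=
  match x with Some (Some _, _) => 4 | Some (None, Some _) => 1 | _ => 0 end.

Definition branch (x : cell) := omap fst x.

(** Distance from the centre to the first vertex of the cell. *)
Definition base (x : cell) :=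
  match x with None => 0 | Some (_, None) => 1 | Some (_, Some _) => 2 end.

Definition vert : finType := {x : cell & 'I_(clen x)}.

Implicit Types (x y : cell) (u v w : vert).

Definition pos u : nat := tagged u.

Definition ht u := base (tag u) + pos u.

(** Geodesics between different branches pass through the centre, which is at
    distance [ht] from a vertex, and those between different cells of one branch
    through the root of the branch, which is one step nearer. *)
Definition tdist u v :=
  if branch (tag u) != branch (tag v) then ht u + ht v
  else if tag u != tag v then (ht u).-1 + (ht v).-1
  else (ht u - ht v) + (ht v - ht u).

Lemma clen_gt0 x : 0 < clen x. Proof. by case: x => [[[?|] ?]|]. Qed.

Definition vtx x (t : 'I_(clen x)) : vert := Tagged (fun x => 'I_(clen x)) t.

Definition top x : vert := vtx (Ordinal (clen_gt0 x)).

Definition hub_of (b : option (option 'I_m)) : cell := omap (fun b => (b, None)) b.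

Definition up x : cell := if x is Some (b, Some _) then Some (b, None) else None.

Definition par u : vert :=
  if pos u == 0 then top (up (tag u))
  else vtx (Ordinal (leq_ltn_trans (leq_pred _) (ltn_ord (tagged u)))).

Lemma eq_cell (b c : option 'I_m) (r s : option 'I_N) :
  (Some (b, r) == Some (c, s) :> cell) = (b == c) && (r == s).
Proof. by []. Qed.

Lemma vert_inj u v : tag u = tag v -> pos u = pos v -> u = v.
Proof.
case: u v => [x t] [y s] /= xy; case: y / xy s => s ts.
by congr existT; apply: val_inj.
Qed.

Lemma same_branch x y : branch x = branch y -> x != y ->
  [/\ 0 < base x, 0 < base y & 2 < base x + base y].
Proof.
by case: x y => [[b [r|]]|] [[c [s|]]|] //= [->]; rewrite ?eqxx.
Qed.

Lemma branch_base x y : branch x != branch y -> 0 < base x + base y.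
Proof. by case: x y => [[b [r|]]|] [[c [s|]]|]. Qed.

Lemma tdist_sym u v : tdist u v = tdist v u.
Proof.
rewrite /tdist (eq_sym (branch _)) (eq_sym (tag u)).
by case: ifP => _; [|case: ifP => _]; rewrite addnC.
Qed.

Lemma tdist_eq0 u v : (tdist u v == 0) = (u == v).
Proof.
rewrite /tdist; have [->|uv] := eqVneq u v; first by rewrite !eqxx /=; lia.
have [buv|buv] /= := eqVneq (branch (tag u)) (branch (tag v)); last first.
  by have := branch_base buv; rewrite /ht; lia.
have [tuv|tuv] /= := eqVneq (tag u) (tag v); last first.
  by have [] := same_branch buv tuv; rewrite /ht; lia.
apply/negP => huv; move/eqP: uv; apply; apply: vert_inj => //.
by move: huv; rewrite /ht tuv; lia.
Qed.

Lemma tdist_tri u v w : tdist u w <= tdist u v + tdist v w.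
Proof.
rewrite /tdist.
have B x y : [&& branch x == branch y & x != y] ==> (0 < base x) && (0 < base y).
  by apply/implyP=> /andP[/eqP bxy xy]; have [-> ->] := same_branch bxy xy.
have Tr (A : eqType) (x y z : A) : (x == y) && (y == z) ==> (x == z).
  by apply/implyP=> /andP[/eqP -> /eqP ->].
have Br x y : (x == y) ==> (branch x == branch y) by apply/implyP=> /eqP ->.
(* The facts about equality of cells and of branches below make this a finite
   check over the possible coincidences, each one linear arithmetic. *)
move: (B (tag u) (tag v)) (B (tag v) (tag w)) (B (tag u) (tag w)).
move: (Br (tag u) (tag v)) (Br (tag v) (tag w)) (Br (tag u) (tag w)).
have TrP (A : eqType) (x y z : A) := (Tr A x y z, Tr A y x z, Tr A x z y).
move: (TrP _ (tag u) (tag v) (tag w)).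
move: (TrP _ (branch (tag u)) (branch (tag v)) (branch (tag w))).
rewrite (eq_sym (tag v) (tag u)) (eq_sym (tag w) (tag v)).
rewrite (eq_sym (branch (tag v)) (branch (tag u))).
rewrite (eq_sym (branch (tag w)) (branch (tag v))).
case=> -[T1 T2] T3 -[[T4 T5] T6]; move: T1 T2 T3 T4 T5 T6.
rewrite /ht {B Tr TrP Br}.
move: (base _) (base _) (base _) (pos u) (pos v) (pos w) => bu bv bw pu pv pw.
do 3 case: (branch _ == branch _) => //=; do 3 case: (tag _ == tag _) => //=; lia.
Qed.

Lemma ht_par u : ht (par u) <= ht u.
Proof.
rewrite /par /ht; case: eqP => [->|_] /=; last by rewrite /pos /=; lia.
by case: (tag u) => [[b [r|]]|].
Qed.

Lemma tdist_par u v : ht v <= ht u -> u != v -> tdist u v = (tdist (par u) v).+1.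
Proof.
rewrite /par; case: (posnP (pos u)) => [u0|upos]; last first.
  move=> hvu uv; rewrite /tdist /=.
  set lt := leq_ltn_trans _ _.
  have hE : ht u = (ht (vtx (Ordinal lt))).+1.
    rewrite /ht /= /pos /=; move: upos; rewrite /pos.
    by case: (nat_of_ord _) => [|t] // _; rewrite addnS.
  move: (ht (vtx _)) hE => hw hE; rewrite hE.
  have [buv|_] := eqVneq (branch (tag u)) (branch (tag v)); last by [].
  have [tuv|tuv] /= := eqVneq (tag u) (tag v).
    suff : ht u != ht v by lia.
    apply: contra uv; rewrite /ht tuv => /eqP huv.
    by apply/eqP/vert_inj => //; lia.
  have [] := same_branch buv tuv; move: hvu hE; rewrite /ht /=; lia.
move=> hvu uv; have huE : ht u = base (tag u) by rewrite /ht u0 addn0.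
have tuv : ht v = base (tag v) -> tag u != tag v.
  move=> hv; apply: contra uv => /eqP tuv; apply/eqP; apply: vert_inj => //.
  by move: hv; rewrite u0 /ht; lia.
move: hvu; rewrite /tdist huE.
have -> : ht (top (up (tag u))) = base (up (tag u)) by rewrite /ht addn0.
move: tuv; rewrite /ht /=.
case: (tag u) (tag v) => [[b [r|]]|] [[c [s|]]|] //=.
all: try lia.
all: rewrite !eq_cell (_ : (Some b == Some c) = (b == c)) //.
all: rewrite ?(inj_eq (@Some_inj _)) //=.
all: case: (b == c) => //=; try case: (r == s) => //=; lia.
Qed.

End TreeMetric.

Section TreeBroadcasts.
Variables m N : nat.
Notation cell := (cell m N).
Notation vert := (vert m N).
Notation top := (@top m N).
Implicit Types (x y : cell) (u v w : vert).

Definition tree : rel vert := unit_dist (@tdist m N).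

Lemma card_vert : 1 < #|vert|.
Proof.
have tops : top None != top (Some (None, None)).
  by rewrite -tdist_eq0.
have := subset_leq_card (subsetT [set top None; top (Some (None, None))]).
by rewrite cards2 tops cardsT.
Qed.

Lemma dist_tree u v : dist tree u v = tdist u v.
Proof.
exact: (dist_unit_dist (@tdist_sym m N) (@tdist_eq0 m N) (@tdist_tri m N)
          (@ht_par m N) (@tdist_par m N)).
Qed.

Lemma is_tree_tree : is_tree tree.
Proof.
apply: (unit_dist_tree (@tdist_sym m N) (@tdist_eq0 m N)
          (@ht_par m N) (@tdist_par m N)).
exact: ltnW card_vert.
Qed.

Lemma sum_vert (P : pred vert) (F : vert -> nat) :
  \sum_(u | P u) F u =
  \sum_(x : cell) \sum_(t : 'I_(clen x) | P (vtx t)) F (vtx t).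
Proof.
rewrite (@sig_big_dep _ _ _ cell (fun x => 'I_(clen x) : finType) xpredT
           (fun x t => P (@vtx m N x t))
           (fun x t => F (@vtx m N x t))).
by apply: eq_big => [[x t]|[x t]].
Qed.

Lemma pos_lt u : pos u < clen (tag u).
Proof. exact: ltn_ord. Qed.

Lemma ht_le u : ht u <= 6.
Proof.
have := pos_lt u; rewrite /ht.
by case: (tag u) => [[[b|] [r|]]|] /=; lia.
Qed.

Lemma tdist_le u v : tdist u v <= 12.
Proof.
have := ht_le u; have := ht_le v; rewrite /tdist.
by case: ifP => _; [|case: ifP => _]; lia.
Qed.

Lemma ht_top x : ht (top x) = base x.
Proof. exact: addn0. Qed.

Lemma tdist_center u : tdist u (top None) = ht u.
Proof.
rewrite /tdist ht_top /= subn0 !addn0.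
by case: (tag u) => [[b r]|].
Qed.

(** * A bnr-independent broadcast *)

Section Witness.

(** The value [cap] at the end of every cell, which is 4 at the end of a chain
    and 1 at a leaf of the star. *)
Definition end_value u := if (pos u).+1 == clen (tag u) then cap (tag u) else 0.

Lemma end_value_gt0 u : 0 < end_value u ->
  [/\ (pos u).+1 = clen (tag u), end_value u = cap (tag u) & 0 < cap (tag u)].
Proof. by rewrite /end_value; case: eqP. Qed.

(** The vertices outside the cell that are reached can only be the hub of the
    star, reached from a leaf. *)
Lemma end_value_ball u w : 0 < end_value u -> tdist u w <= end_value u ->
  tag w = tag u \/ tdist u w = end_value u /\ cap (tag w) = 0.
Proof.
move=> /end_value_gt0[pu -> cu]; rewrite /tdist.
have [buw|_] /= := eqVneq (branch (tag u)) (branch (tag w)); last first.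
  by move: pu cu; rewrite /ht; case: (tag u) => [[[b|] [r|]]|] /=; lia.
have [->|tuw] /= := eqVneq (tag u) (tag w); first by left.
have [bu bw buw3] := same_branch buw tuw.
move: pu cu buw bu bw buw3; rewrite /ht.
by case: (tag u) (tag w) => [[[b|] [r|]]|] [[[c|] [s|]]|] //=; lia.
Qed.

Lemma end_value_top u v : 0 < end_value u -> 0 < end_value v ->
  tdist (top (tag u)) v <= end_value v -> u = v.
Proof.
move=> u0 v0; rewrite tdist_sym => /(end_value_ball v0) /= tuv.
have [pu _ cu] := end_value_gt0 u0; have [pv _ _] := end_value_gt0 v0.
case: tuv => [tuv|[_ c0]]; last by rewrite c0 in cu.
by apply: vert_inj => //; move: pu; rewrite tuv -pv; case.
Qed.

Lemma end_value_ht u : end_value u <= ht u.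
Proof.
rewrite /end_value /ht; case: eqP => // pu.
by move: pu; case: (tag u) => [[[b|] [r|]]|] /=; lia.
Qed.

Variable f : bfun tree.
Hypothesis fE : forall u, f u = end_value u.

Lemma end_broadcast : is_broadcast tree f.
Proof.
rewrite /is_broadcast ifN; last by rewrite neq_ltn card_vert orbT.
apply/forallP=> u; rewrite fE; apply: leq_trans (end_value_ht u) _.
rewrite -tdist_center -dist_tree.
exact: (leq_bigmax (F := fun w => dist tree u w)).
Qed.

Lemma end_bn_independent : bn_independent tree f.
Proof.
apply/forall_inP=> u; rewrite inE fE => u0; apply/forall_inP=> v.
rewrite inE fE => v0; apply/implyP=> uv; apply/subsetP=> w.
rewrite !inE !fE !dist_tree !(tdist_sym w) => /andP[uw vw].
have [pu _ cu] := end_value_gt0 u0; have [pv _ cv] := end_value_gt0 v0.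
case: (end_value_ball u0 uw) => [twu|[-> cw]];
  case: (end_value_ball v0 vw) => [twv|[-> cw']].
- case/eqP: uv; apply: vert_inj; first by rewrite -twu.
  by move: pu; rewrite -twu twv -pv; case.
- by move: cu; rewrite -twu cw'.
- by move: cv; rewrite -twv cw.
- by rewrite !eqxx.
Qed.

(** The first vertex of a chain is at distance exactly 4 from the broadcasting
    end, and a leaf is private to itself. *)
Lemma end_irredundant : irredundant tree f.
Proof.
apply/forall_inP=> u; rewrite inE fE => u0; apply/set0Pn; exists (top (tag u)).
have [pu vu cu] := end_value_gt0 u0.
have Dt : tdist (top (tag u)) u = pos u.
  by rewrite /tdist !eqxx /= /ht /= /pos /=; lia.
have pc : pos u = cap (tag u) \/ pos u = 0 /\ cap (tag u) = 1.
  by move: pu cu; case: (tag u) => [[[b|] [r|]]|] /=; lia.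
rewrite !inE dist_tree fE vu Dt; apply/andP; split; first lia.
apply/existsPn=> v; rewrite /hears inE /lower_at dist_tree !fE.
case: (v =P u) => [->|vu']; first by rewrite Dt vu; lia.
by apply/negP=> /andP[v0 Dv]; apply: vu'; rewrite (end_value_top u0 v0 Dv).
Qed.

Lemma end_weight : weight f = \sum_(x : cell) cap x.
Proof.
rewrite /weight (eq_bigr _ (fun u _ => fE u)).
rewrite (sum_vert xpredT); apply: eq_bigr => x _.
have ltl : (clen x).-1 < clen x by rewrite prednK ?clen_gt0.
rewrite (bigD1 (Ordinal ltl)) //= big1 => [|t tl].
  by rewrite /end_value /pos /= prednK ?clen_gt0 // eqxx addn0.
rewrite /end_value /pos /=; case: eqP => // tE; case/eqP: tl.
by apply: val_inj; exact: (congr1 predn tE).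
Qed.

End Witness.

Lemma cap_sum_le_alpha_bnr : \sum_(x : cell) cap x <= alpha_bnr tree.
Proof.
have lt u : end_value u < (maxn 1 (diam tree)).+1.
  rewrite ltnS leq_max; apply/orP; right.
  apply: leq_trans (end_value_ht u) _.
  rewrite -tdist_center -dist_tree.
  apply: leq_trans (leq_bigmax (F := fun w => dist tree u w) (top None)) _.
  exact: (leq_bigmax (F := ecc tree)).
pose f : bfun tree := [ffun u => Ordinal (lt u)].
have fE u : f u = end_value u by rewrite /bval ffunE.
rewrite -(end_weight fE); apply: leq_bigmax_cond.
by rewrite end_broadcast // /bnr_independent end_bn_independent // end_irredundant.
Qed.

(** * The loss of a dominating irredundant broadcast *)

Lemma tdist_cell u v : tag u = tag v ->
  tdist u v = (pos u - pos v) + (pos v - pos u).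
Proof. by rewrite /tdist /ht => ->; rewrite !eqxx /=; lia. Qed.

Section UpperBound.
Variables (f : vert -> nat) (p : vert -> vert).
Hypothesis private : forall b, 0 < f b ->
  [/\ tdist (p b) b <= f b, f b <= maxn 1 (tdist (p b) b) &
      forall b', b' != b -> 0 < f b' -> f b' < tdist (p b) b'].

(** The geodesic from u to its private vertex stays in the cell of u, and is
    counted against the capacity of that cell. *)
Definition local u := (tag (p u) == tag u) && (0 < cap (tag u)).
Definition cell_weight x := \sum_(t : 'I_(clen x) | local (vtx t)) f (vtx t).

Definition roaming := [set u | ~~ local u & 0 < f u].

Definition covered x z :=
  [&& 0 < f z, tag z != x & tdist z (top x) <= f z].

Lemma value_le u : f u <= 12.
Proof.
have [-> //|u0] := posnP (f u); have [_ fu _] := private u0.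
by have := tdist_le (p u) u; lia.
Qed.

Lemma private_top z u : covered (tag u) z -> 0 < f u -> p u != top (tag u).
Proof.
move=> /and3P[z0 zx zu] u0; have [_ _ /(_ z)] := private u0.
have z_u : z != u by apply: contra zx => /eqP ->.
move=> /(_ z_u z0) pz; apply/eqP=> pu.
by move: pz; rewrite pu tdist_sym ltnNge zu.
Qed.

(** Transport of the weight bounds for the path 0, ..., 4 to one chain. *)
Section Chain.
Variables (i : 'I_m) (o : option 'I_N).
Let x : cell := Some (Some i, o).
Let v t : vert := @vtx m N x (inord t : 'I_5).
Let F t := if local (v t) then f (v t) else 0.
Let P t := pos (p (v t)).

Let pos_v t : t < 5 -> pos (v t) = t.
Proof. by move=> t5; rewrite /pos /= inordK. Qed.

Let F_gt0 t : 0 < F t -> [/\ tag (p (v t)) = x, 0 < f (v t) & F t = f (v t)].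
Proof. by rewrite /F; case: ifP => // /andP[/eqP]. Qed.

Let cell_weightE : cell_weight x = \sum_(0 <= t < 5) F t.
Proof.
rewrite big_mkord /cell_weight big_mkcond; apply: eq_bigr => t _.
by rewrite /F /v inord_val.
Qed.

Let F_bound t : t < 5 -> 0 < F t ->
  [/\ P t < 5, (t - P t) + (P t - t) <= F t &
      F t <= maxn 1 ((t - P t) + (P t - t))].
Proof.
move=> t5 Ft; have [tp f0 ->] := F_gt0 Ft; have [] := private f0.
rewrite tdist_sym tdist_cell ?tp // pos_v // => h1 h2 _; split=> //.
by have := pos_lt (p (v t)); rewrite tp.
Qed.

Let F_private s t : s < 5 -> t < 5 -> s != t -> 0 < F s -> 0 < F t ->
  F s < (s - P t) + (P t - s).
Proof.
move=> s5 t5 st Fs Ft; have [_ fs ->] := F_gt0 Fs.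
have [tp ft _] := F_gt0 Ft; have [_ _ /(_ (v s))] := private ft.
rewrite tdist_sym tdist_cell ?tp // pos_v //; apply=> //.
by apply: contra st => /eqP/(congr1 (@pos m N)); rewrite !pos_v // => ->.
Qed.

Lemma chain_cell_weight : cell_weight x <= 4.
Proof. by rewrite cell_weightE; apply: chain_weight F_bound F_private. Qed.

Lemma covered_chain_cell_weight z : covered x z -> f (top x) < 4 ->
  cell_weight x < 4.
Proof.
move=> cz ft; rewrite cell_weightE ltnS.
apply: chain_weight_top F_bound F_private _ _ => [t t5 Ft|].
  have [tp f0 _] := F_gt0 Ft; apply: contra (private_top (u := v t) cz f0).
  by move=> /eqP P0; apply/eqP; apply: vert_inj; rewrite ?tp ?P0.
rewrite /F (_ : v 0 = top x); first by case: ifP.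
by apply: vert_inj; rewrite ?pos_v.
Qed.

End Chain.

(** A local broadcast at a leaf is its own private vertex, so its value is 1. *)
Lemma leaf_cell_weight r : cell_weight (Some (None, Some r)) <= 1.
Proof.
rewrite /cell_weight /= big_mkcond big_ord1; case: ifP => // /andP[/eqP tp _].
set u := vtx _ in tp *; have [-> //|u0] := posnP (f u).
have [_ + _] := private u0; rewrite tdist_cell //.
have := pos_lt (p u); rewrite tp /= => pp; have := pos_lt u => /= pu; lia.
Qed.

Lemma covered_leaf_cell_weight r z : covered (Some (None, Some r)) z ->
  cell_weight (Some (None, Some r)) < 1.
Proof.
move=> cz; rewrite /cell_weight /= big_mkcond big_ord1.
case: ifP => // /andP[/eqP tp _]; set u := vtx _ in tp *.
rewrite ltnS leqn0 -leqn0 leqNgt; apply/negP=> u0.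
have /eqP := private_top (u := u) cz u0; apply; apply: vert_inj => //.
by have := pos_lt (p u); rewrite tp /=; case: (pos _).
Qed.

Lemma cell_weight_le x : cell_weight x <= cap x.
Proof.
case: x => [[[i|] o]|]; first exact: chain_cell_weight.
  case: o => [r|]; first exact: leaf_cell_weight.
all: by rewrite /cell_weight big1 // => t; rewrite /local andbF.
Qed.

Definition lossy := [set x | cell_weight x < cap x].

Lemma weight_bound :
  weight f + #|lossy| <= 12 * #|roaming| + \sum_(x : cell) cap x.
Proof.
rewrite /weight (bigID local) /= sum_vert -addnA addnCA.
apply: leq_add; last first.
  have -> : #|lossy| = \sum_(x : cell) (cell_weight x < cap x).
    rewrite -sum1_card big_mkcond; apply: eq_bigr => x _.
    by rewrite inE; case: ltnP.
  rewrite -big_split /=; apply: leq_sum => x _; rewrite -/(cell_weight x).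
  by have := cell_weight_le x; case: ltnP => /=; lia.
rewrite (bigID (fun u => 0 < f u)) /= [X in _ + X]big1 => [|u /andP[_]]; last lia.
rewrite addn0 mulnC -sum_nat_const.
rewrite [leqRHS](eq_bigl (fun u => ~~ local u && (0 < f u))) => [|u].
  by apply: leq_sum => u _; apply: value_le.
by rewrite inE.
Qed.

(** The vertex through which a geodesic that is not local has to pass: the centre
    when it changes branch, the root of its branch otherwise. *)
Definition pass_cell u : cell :=
  hub_of N (if branch (tag (p u)) == branch (tag u) then branch (tag u) else None).

Lemma pass_between u : ~~ local u ->
  tdist (p u) u = tdist (p u) (top (pass_cell u)) + tdist (top (pass_cell u)) u.
Proof.
rewrite /local /pass_cell => nl.
have [bE|bN] := eqVneq (branch (tag (p u))) (branch (tag u)); last first.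
  by rewrite (tdist_sym (top _)) !tdist_center /tdist bN.
have hubE x : branch (hub_of N (branch x)) = branch x by case: x => [[]|].
have tE w : branch (tag w) = branch (tag u) ->
    tdist w (top (hub_of N (branch (tag u)))) = ht w - (branch (tag u) != None).
  move=> bw; rewrite /tdist /= hubE bw eqxx /= ht_top.
  have := pos_lt w; rewrite /ht; move: bw.
  case: (tag u) (tag w) => [[b r]|] [[c [s|]]|] //=.
  - by move=> [->]; rewrite eq_cell eqxx /=; lia.
  - by move=> [->]; rewrite ?eqxx /=; lia.
  - by lia.
rewrite (tdist_sym (top _)) !tE // /tdist bE eqxx /=.
move: nl bE; rewrite /ht; have := pos_lt u; have := pos_lt (p u).
have [->|tN _ _ _ bE] /= := eqVneq (tag (p u)) (tag u).
  by case: (tag u) => [[[b|] [r|]]|] /=; rewrite ?eqxx //=; lia.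
have uN : branch (tag u) != None.
  by move: tN bE; case: (tag u) (tag (p u)) => [[? ?]|] [[? ?]|].
by rewrite uN !subn1.
Qed.

(** Disjointness of the geodesics: if two pass through the same vertex, the one
    whose private vertex is farther from it reaches the other private vertex. *)
Lemma pass_inj : {in roaming &, injective pass_cell}.
Proof.
move=> u v; rewrite !inE => /andP[lu u0] /andP[lv v0] uv.
apply/eqP/negPn/negP => nuv; have nvu : v != u by rewrite eq_sym.
have [fu _ /(_ v nvu v0) uv'] := private u0.
have [fv _ /(_ u nuv u0) vu'] := private v0.
have := tdist_tri (p u) (top (pass_cell v)) v.
have := tdist_tri (p v) (top (pass_cell v)) u.
move: (pass_between lu) (pass_between lv); rewrite uv; lia.
Qed.

Lemma card_roaming : #|roaming| <= m.+2.
Proof.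
rewrite -(card_in_imset pass_inj).
pose H := hub_of N @: [set: option (option 'I_m)].
apply: leq_trans (_ : #|H| <= _).
  apply: subset_leq_card; apply/subsetP=> _ /imsetP[u _ ->].
  by apply: imset_f; rewrite inE.
by apply: leq_trans (leq_imset_card _ _) _; rewrite cardsT !card_option card_ord.
Qed.

(** The children of one branch root, apart from those in A, are all lossy.  The
    exception is there for the cell of the vertex that covers the others. *)
Lemma sibling_bound b (A : {set cell}) :
  (forall r, Some (b, Some r) \notin A -> Some (b, Some r) \in lossy) ->
  N <= #|lossy| + #|A|.
Proof.
move=> hA; pose S := [set (Some (b, Some r) : cell) | r : 'I_N].
have SN : #|S| = N by rewrite card_imset ?card_ord // => r s [].
apply: (leq_trans (eq_leq (esym SN))).
rewrite -(cardsID A S) addnC leq_add //; last by rewrite subset_leq_card ?subsetIr.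
apply: subset_leq_card; apply/subsetP=> x /setDP[/imsetP[r _ ->]]; exact: hA.
Qed.

Lemma covered_leaves z :
  0 < f z -> (forall r, tdist z (top (Some (None, Some r))) <= f z) ->
  N <= #|lossy| + 1.
Proof.
move=> z0 hz; rewrite -(cards1 (tag z)); apply: (@sibling_bound None) => r.
rewrite !inE => rz; apply: (@covered_leaf_cell_weight _ z).
by rewrite /covered z0 hz eq_sym rz.
Qed.

(** The height of z is its distance to the centre, so z dominates the centre.
    The value 4 at the child of a branch root is the one case in which a covered
    chain keeps its weight, by broadcasting outwards; it is also the distance
    from there to the leaves of the star. *)
Lemma outer_center_lossy z : 0 < f z -> tag z != None -> ht z <= f z ->
  N <= #|lossy| + 1.
Proof.
move=> z0; case zE : (tag z) => [[b o]|] // _ hz.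
case: b => [i|] in zE; last first.
  apply: (covered_leaves z0) => r; apply: leq_trans hz.
  rewrite /tdist zE /= ht_top.
  have := pos_lt z; rewrite /ht zE /=.
  by case: o {zE} => [s|] /=; rewrite /pos /=; try case: ifP => _ /=; lia.
have [r hr|small] := pickP (fun r => 3 < f (top (Some (Some i, Some r)))).
  apply: (@covered_leaves (top (Some (Some i, Some r)))) => [|s]; first lia.
  by rewrite /tdist !ht_top /=.
rewrite -(cards1 (tag z)); apply: (@sibling_bound (Some i)) => r.
rewrite !inE => rz; apply: (@covered_chain_cell_weight _ _ z); last first.
  by rewrite ltnNge small.
rewrite /covered z0 eq_sym rz /=; apply: leq_trans hz.
rewrite /tdist zE /= eqxx /= ht_top /ht zE /=.
by case: o {zE rz} => [s|] /=; rewrite /pos /=; try case: ifP => _ /=; lia.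
Qed.

(** The private vertex of a broadcast outside the centre is at distance at least
    2 from the centre, because it does not hear the centre.  If the geodesic to
    it leaves its cell, it is long enough for its broadcast to dominate the
    centre, which is excluded.  No branch root broadcasts either, since it would
    dominate the centre; so the chain at
    the root of each branch Some i, covered by the centre, loses 1. *)
Lemma center_only :
  0 < f (top None) ->
  (forall z, 0 < f z -> tag z != None -> f z < ht z) ->
  #|roaming| <= 1 /\ m <= #|lossy|.
Proof.
move=> c0 outer; split.
  rewrite -(cards1 (top None)); apply: subset_leq_card; apply/subsetP=> u.
  rewrite !inE => /andP[lu u0]; apply: contraR lu => uc.
  have uN : tag u != None.
    apply: contra uc => /eqP uN; apply/eqP; apply: vert_inj => //.
    by have := pos_lt u; rewrite uN; case: (pos u).
  have fu := outer u u0 uN; have [pu _ /(_ (top None))] := private u0.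
  rewrite eq_sym uc tdist_center => /(_ isT c0) cp.
  move: pu; rewrite /tdist /local.
  have [bE|_] /= := eqVneq (branch (tag (p u))) (branch (tag u)); last by lia.
  have [tE _|tN] /= := eqVneq (tag (p u)) (tag u); last by lia.
  have := pos_lt u; move: fu cp uN; rewrite /ht tE; have := pos_lt (p u); rewrite tE.
  by case: (tag u) => [[[b|] [r|]]|] //=; lia.
pose S := [set (Some (Some i, None) : cell) | i : 'I_m].
have Sm : #|S| = m by rewrite card_imset ?card_ord // => i j [].
apply: (leq_trans (eq_leq (esym Sm))).
apply: subset_leq_card; apply/subsetP=> _ /imsetP[i _ ->].
set x := Some _; rewrite inE; apply: (@covered_chain_cell_weight _ _ (top None)).
  by rewrite /covered c0.
have [-> //|x0] := posnP (f (top x)).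
by have := outer (top x) x0 isT; rewrite ht_top /=; lia.
Qed.

(** In the two cases the gain of at most 12 for each roaming broadcast, of which
    there are m + 2 or one, is outweighed by the loss of N - 1 or m. *)
Lemma weight_add_le k : (forall u, exists2 v, 0 < f v & tdist u v <= f v) ->
  m = k + 12 -> N = 12 * m.+2 + k + 1 ->
  weight f + k <= \sum_(x : cell) cap x.
Proof.
move=> dom mE NE; have bound := weight_bound.
have [z /andP[/andP[z0 zN] hz]|none] :=
    pickP (fun z => (0 < f z) && (tag z != None) && (ht z <= f z)).
  by have := outer_center_lossy z0 zN hz; have := card_roaming; lia.
have outer z : 0 < f z -> tag z != None -> f z < ht z.
  by move=> z0 zN; have := none z; rewrite z0 zN /= ltnNge => ->.
have c0 : 0 < f (top None).
  have [v v0] := dom (top None); rewrite tdist_sym tdist_center => vc.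
  have [vN|vN] := eqVneq (tag v) None; last by have := outer v v0 vN; lia.
  suff <- : v = top None by [].
  apply: vert_inj => //.
  by have := pos_lt v; rewrite vN; case: (pos v).
by have [] := center_only c0 outer; lia.
Qed.

End UpperBound.

Lemma Gamma_b_bound k : m = k + 12 -> N = 12 * m.+2 + k + 1 ->
  Gamma_b tree + k <= \sum_(x : cell) cap x.
Proof.
move=> mE NE.
(* Subtraction on nat is truncated, so k <= W is needed on its own. *)
have k_le : k <= \sum_(x : cell) cap x.
  apply: leq_trans (_ : N <= _); first lia.
  pose S := [set (Some (None, Some r) : cell) | r : 'I_N].
  have SN : #|S| = N by rewrite card_imset ?card_ord // => r s [].
  apply: (leq_trans (eq_leq (esym SN))).
  rewrite -sum1_card big_mkcond; apply: leq_sum => x _.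
  by case: ifP => // /imsetP[r _ ->].
suff : Gamma_b tree <= (\sum_(x : cell) cap x) - k by lia.
apply/bigmax_leqP=> f mf; rewrite leq_subRL // addnC.
have [p pP] := irredundant_private (minimal_dominating_irredundant card_vert mf).
apply: (@weight_add_le _ p) => // [b fb|u].
  have [h1 h2 h3] := pP b fb; rewrite -dist_tree; split=> // b' bb' fb'.
  by rewrite -dist_tree; apply: h3.
case/and3P: mf => _ /forallP/(_ u)/existsP[v /andP[]].
by rewrite inE dist_tree; exists v.
Qed.

End TreeBroadcasts.

Theorem theorem4p6 (k : nat) (hk : 1 <= k) :
  exists (T : finType) (e : rel T),
    is_tree e /\
    ((alpha_bn e)%:Z - (Gamma_b e)%:Z >= (alpha_bnr e)%:Z - (Gamma_b e)%:Z)%R /\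
    ((alpha_bnr e)%:Z - (Gamma_b e)%:Z >= k%:Z)%R.
Proof.
pose m := k + 12; pose N := 12 * m.+2 + k + 1.
exists (vert m N), (@tree m N); split; first exact: is_tree_tree.
have bn : alpha_bnr (@tree m N) <= alpha_bn (@tree m N).
  apply/bigmax_leqP => f /andP[bf /andP[bnf _]].
  by apply: leq_bigmax_cond; rewrite bf bnf.
have lo := cap_sum_le_alpha_bnr m N.
have hi : Gamma_b (@tree m N) + k <= _ := Gamma_b_bound erefl erefl.
have := leq_trans hi lo; move: bn.
move: (alpha_bn _) (alpha_bnr _) (Gamma_b _) => a b g {lo hi} ab gb.
by split; lia.
Qed.
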